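(* Let $Y$ be a finite-dimensional vector space and let $\Theta=\Psi\circ\mathcal A_{E,\mathrm{core}}:S\to Y$ be a core-package-generated observable, with canonical response operator $\mathcal R_{g_0}=D_{p_0}\Theta:T_{p_0}S\to Y$. Then $$\mathcal R_{g_0}=D_{\mathcal A_{E,\mathrm{core}}(p_0)}\Psi\circ\mathcal D_{g_0},$$ equivalently $D_{p_0}\Theta=D_{\mathcal A_{E,\mathrm{core}}(p_0)}\Psi\circ D_{p_0}\mathcal A_{E,\mathrm{core}}$. Consequently, every core-package-generated response operator factors through the single universal response differential $\mathcal D_{g_0}$.
   Context: $S$ is a smooth finite-dimensional manifold parameterizing a smooth family $p\mapsto g_p$ of normalized cohomogeneity-one Einstein metrics ($\operatorname{Ric}(g_p)=\lambda g_p$, $\lambda>0$ fixed, invariant under a fixed Lie group action, normalized by a fixed unit-speed normal geodesic) on a compact manifold $M$, with $g_{p_0}=g_0$ the reference metric. Fixed probe data are given: a compact Riemannian target $(N,h)$ with compatible group action, an equivariant homotopy class of maps $M\to N$ with endpoint, smoothness and normalization conditions, and a reference harmonic map $f_0$ for $g_0$. Under normalized Jacobi nondegeneracy (the linearization at $f_0$ of the tension field in the map variable, between the constrained equivariant $C^{k+2,\alpha}$ and $C^{k,\alpha}$ Hölder spaces, $k\ge4$, $0<\alpha<1$, is an isomorphism) and after shrinking $S$ around $p_0$, each $g_p$ has a unique harmonic map $f_p$ near $f_0$, depending smoothly on $p$; $J_p$ denotes the linearization at $f_p$ of the tension field $f\mapsto\tau_{g_p}(f)$, which is invertible, and $G_p=J_p^{-1}$.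 The (descended) core analytical package is the smooth map $\mathcal A_{E,\mathrm{core}}:S\to\mathscr X_{\mathrm{core}}$, $p\mapsto(J_p,G_p)$, where (after fixed local trivializations) $\mathscr X_{\mathrm{core}}$ is a Banach manifold of operator data. The universal response differential is $\mathcal D_{g_0}:=D_{p_0}\mathcal A_{E,\mathrm{core}}:T_{p_0}S\to T_{\mathcal A_{E,\mathrm{core}}(p_0)}\mathscr X_{\mathrm{core}}$. A smooth map $\Theta:S\to Y$ into a finite-dimensional vector space is a core-package-generated observable if $\Theta=\Psi\circ\mathcal A_{E,\mathrm{core}}$ for some smooth map $\Psi:\mathscr X_{\mathrm{core}}\to Y$. *)

(* Defs.v *)
From HB Require Import structures.
From mathcomp Require Import all_boot all_order all_algebra.
From mathcomp Require Import all_classical all_reals all_analysis.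

Set Implicit Arguments.
Unset Strict Implicit.
Unset Printing Implicit Defensive.

Import Order.TTheory GRing.Theory Num.Theory.
Import numFieldNormedType.Exports.

Local Open Scope classical_set_scope.
Local Open Scope ring_scope.

Section Operators.
Context (R : realType) (V W : normedModType R).

Definition clin_pred : pred (V -> W) :=
  fun f => `[< linear f /\ continuous f >].

Record clin := Clin { clin_val :> V -> W; clin_valP : clin_val \in clin_pred }.

HB.instance Definition _ := [isSub for clin_val].
HB.instance Definition _ := [Choice of clin by <:].

Lemma clin_predP f : reflect (linear f /\ continuous f) (f \in clin_pred).
Proof. exact: asboolP. Qed.

Lemma clin_linear (f : clin) : linear f.
Proof. by have /clin_predP[] := clin_valP f. Qed.

Lemma clin_continuous (f : clin) : continuous f.
Proof. by have /clin_predP[] := clin_valP f. Qed.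

Lemma clin_submod_closed : submod_closed clin_pred.
Proof.
split=> [|a f g /clin_predP[lf cf] /clin_predP[lg cg]]; apply/clin_predP; split.
- by move=> b u v; rewrite /GRing.zero /= scaler0 addr0.
- by move=> x; exact: cvg_cst.
- move=> b u v; rewrite !fctE lf lg !scalerDr !scalerA mulrC -!addrA.
  by congr (_ + _); rewrite addrCA.
- move=> x; apply: cvgD; last exact: cg.
  by apply: cvgZr; exact: cf.
Qed.

HB.instance Definition _ :=
  GRing.isSubmodClosed.Build R (V -> W) clin_pred clin_submod_closed.
HB.instance Definition _ := [SubChoice_isSubLmodule of clin by <:].

Definition opnorm (f : clin) : R := sup [set `|f x| | x in [set x | `|x| <= 1]].

Let lin (f : clin) : {linear V -> W} :=
  HB.pack (clin_val f) (GRing.isLinear.Build _ _ _ _ _ (clin_linear f)).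

Let img (f : clin) := [set `|f x| | x in [set x : V | `|x| <= 1]].

Let img0 (f : clin) : img f 0.
Proof. by exists 0; rewrite /= ?normr0// -[clin_val f]/(lin f : _ -> _) linear0 normr0. Qed.

Let img_sup (f : clin) : has_sup (img f).
Proof.
split; first by exists 0; exact: img0.
have /linear_boundedP : bounded_near (lin f) (nbhs 0).
  by apply: continuous_linear_bounded; exact: clin_continuous.
move=> /pinfty_ex_gt0[M M0 fM]; exists M => _ [x /= x1 <-].
by rewrite (le_trans (fM x))// ler_piMr// ltW.
Qed.

Lemma opnorm_ge0 (f : clin) : 0 <= opnorm f.
Proof. by apply: ub_le_sup; [case: (img_sup f)|exact: img0]. Qed.

Lemma opnormP (f : clin) x : `|f x| <= opnorm f * `|x|.
Proof.
have [->|x0] := eqVneq x 0.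
  by rewrite -[clin_val f]/(lin f : _ -> _) linear0 !normr0 mulr0.
have nx : 0 < `|x| by rewrite normr_gt0.
rewrite -ler_pdivrMr// mulrC.
have -> : `|x|^-1 * `|f x| = `|f (`|x|^-1 *: x)|.
  by rewrite -[clin_val f]/(lin f : _ -> _) linearZ normrZ normfV normr_id.
apply: ub_le_sup; first by case: (img_sup f).
by exists (`|x|^-1 *: x) => //=; rewrite normrZ normfV normr_id mulVf// gt_eqF.
Qed.

Let opnorm_le (f : clin) M : (forall x, `|x| <= 1 -> `|f x| <= M) -> opnorm f <= M.
Proof.
move=> fM; apply: ge_sup; first by exists 0; exact: img0.
by move=> _ [x x1 <-]; exact: fM.
Qed.

Let opnormD (f g : clin) : opnorm (f + g) <= opnorm f + opnorm g.
Proof.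
apply: opnorm_le => x x1; rewrite (le_trans (ler_normD _ _))// lerD//.
- by rewrite (le_trans (opnormP f x))// ler_piMr// opnorm_ge0.
- by rewrite (le_trans (opnormP g x))// ler_piMr// opnorm_ge0.
Qed.

Let opnormZ_le (a : R) (f : clin) : opnorm (a *: f) <= `|a| * opnorm f.
Proof.
apply: opnorm_le => x x1; rewrite normrZ ler_wpM2l//.
by rewrite (le_trans (opnormP f x))// ler_piMr// opnorm_ge0.
Qed.

Let opnormZ (a : R) (f : clin) : opnorm (a *: f) = `|a| * opnorm f.
Proof.
apply/eqP; rewrite eq_le opnormZ_le /=.
have [->|a0] := eqVneq a 0; first by rewrite normr0 mul0r opnorm_ge0.
rewrite -ler_pdivlMl ?normr_gt0// -normfV.
by rewrite -{1}[f](scalerK a0) opnormZ_le.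
Qed.

Let opnorm_eq0 (f : clin) : opnorm f = 0 -> f = 0.
Proof.
move=> f0; apply/val_inj/funext => x; apply/eqP; rewrite -normr_le0.
by have := opnormP f x; rewrite f0 mul0r.
Qed.

HB.instance Definition _ :=
  Lmodule_isNormed.Build R clin opnormD opnormZ opnorm_eq0.

End Operators.

Section Smoothness.
Context (R : realType).

(* To be used on open sets [U]. *)
Fixpoint Ck_on (k : nat) (V W : normedModType R) (U : set V) (f : V -> W) : Prop :=
  match k with
  | 0 => forall x, U x -> {for x, continuous f}
  | k'.+1 => (forall x, U x -> differentiable f x) /\
      exists Df : V -> clin V W,
        (forall x, U x -> Df x = 'd f x :> (V -> W)) /\ Ck_on k' U Df
  end.

Definition smooth_on (V W : normedModType R) (U : set V) (f : V -> W) :=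
  forall k, Ck_on k U f.

Lemma smooth_on_cst (V W : normedModType R) (U : set V) (w : W) :
  smooth_on U (fun=> w).
Proof.
move=> k; elim: k W w => [|k IH] W w /=; first by move=> x _; exact: cvg_cst.
split; first by move=> x _; exact: differentiable_cst.
exists (fun=> 0); split; last exact: IH.
by move=> x _; rewrite diff_cst.
Qed.

Lemma smooth_on_id (V : normedModType R) (U : set V) (f : V -> V) :
  f =1 id -> smooth_on U f.
Proof.
move=> /funext ->.
have idP : (id : V -> V) \in @clin_pred R V V.
  by apply/clin_predP; split=> // x; exact: cvg_id.
case=> [x _|k]; first exact: cvg_id.
split; first by move=> x _; exact: ex_diff.
exists (fun=> Clin idP); split; last exact: smooth_on_cst.
by move=> x _ /=; rewrite diff_val.
Qed.

End Smoothness.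

Section Manifolds.
Context (R : realType).

(* [cinv] is only meaningful on the image of the chart. *)
Record chart (T : topologicalType) (V : normedModType R) := Chart {
  cdom : set T;
  cmap : T -> V;
  cinv : V -> T;
  cdom_open : open cdom;
  cimg_open : open (cmap @` cdom);
  cmapK : forall x, cdom x -> cinv (cmap x) = x;
  cmap_continuous : forall x, cdom x -> {for x, continuous cmap};
  cinv_continuous : forall y, (cmap @` cdom) y -> {for y, continuous cinv}
}.

Definition cimg T V (c : chart T V) : set V := cmap c @` cdom c.

(* A Banach manifold when [V] is complete, and an ordinary [d]-dimensional
   manifold when [V] is ['rV[R]_d].  [chart_at x] selects a chart around [x]. *)
Record manifold (V : normedModType R) := Manifold {
  mpoint :> topologicalType;
  atlas : set (chart mpoint V);
  chart_at : mpoint -> chart mpoint V;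
  chart_at_atlas : forall x, atlas (chart_at x);
  chart_at_dom : forall x, cdom (chart_at x) x;
  manifold_hausdorff : hausdorff_space mpoint;
  atlas_compat : forall c d, atlas c -> atlas d ->
    smooth_on (cmap c @` (cdom c `&` cdom d)) (cmap d \o cinv c)
}.

(* A tangent vector at [x] is represented by its coordinates in [chart_at x]. *)
Definition tangent V (A : manifold V) (x : A) : normedModType R := V.

(* Coordinates in the chart [d], around [q], of a tangent vector at [q]. *)
Definition tcoord V (A : manifold V) (d : chart A V) (q : A) (v : tangent q) : V :=
  'd (cmap d \o cinv (chart_at q)) (cmap (chart_at q) q) v.

(* The tangent vector at [cinv c y] whose coordinates in the chart [c] are [w]. *)
Definition tvec V (A : manifold V) (c : chart A V) (y w : V) : tangent (cinv c y) :=
  'd (cmap (chart_at (cinv c y)) \o cinv c) y w.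

Definition rep_dom V W (A : manifold V) (B : manifold W) (f : A -> B)
    (c : chart A V) (d : chart B W) : set V :=
  [set y | cimg c y /\ cdom d (f (cinv c y))].

Definition rep V W (A : manifold V) (B : manifold W) (f : A -> B)
    (c : chart A V) (d : chart B W) : V -> W :=
  cmap d \o f \o cinv c.

Definition msmooth V W (A : manifold V) (B : manifold W) (f : A -> B) :=
  continuous f /\ forall c d, atlas c -> atlas d ->
    smooth_on (rep_dom f c d) (rep f c d).

Definition msmooth2 U V W (A : manifold U) (B : manifold V) (C : manifold W)
    (f : A -> B -> C) :=
  continuous (fun z : A * B => f z.1 z.2) /\
  forall a b c, atlas a -> atlas b -> atlas c ->
    smooth_on
      [set z : U * V | cimg a z.1 /\ cimg b z.2 /\
                       cdom c (f (cinv a z.1) (cinv b z.2))]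
      (fun z => cmap c (f (cinv a z.1) (cinv b z.2))).

Definition mdiff V W (A : manifold V) (B : manifold W) (f : A -> B) (x : A) :
    {linear tangent x -> tangent (f x)} :=
  'd (rep f (chart_at x) (chart_at (f x))) (cmap (chart_at x) x).

Section NormedSpaceManifold.
Context (V : normedModType R).

Lemma idchart_img : open (@id V @` setT).
Proof. by rewrite image_id; exact: openT. Qed.

Definition idchart : chart V V :=
  @Chart V V setT id id openT idchart_img (fun _ _ => erefl)
    (fun x _ => @cvg_id V (nbhs x)) (fun x _ => @cvg_id V (nbhs x)).

Lemma idchart_compat (c d : chart V V) :
  [set idchart] c -> [set idchart] d ->
  smooth_on (cmap c @` (cdom c `&` cdom d)) (cmap d \o cinv c).
Proof. by move=> -> ->; exact: smooth_on_id. Qed.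

Definition nmanifold : manifold V :=
  @Manifold V V [set idchart] (fun=> idchart) (fun=> erefl) (fun=> I)
    (@norm_hausdorff R V) idchart_compat.

End NormedSpaceManifold.

Definition findim (V : normedModType R) :=
  exists d, exists f : 'rV[R]_d -> V, linear f /\ bijective f.

Record lie_group (V : normedModType R) := LieGroup {
  lg_manifold :> manifold V;
  lg_one : lg_manifold;
  lg_mul : lg_manifold -> lg_manifold -> lg_manifold;
  lg_inv : lg_manifold -> lg_manifold;
  lg_mulA : associative lg_mul;
  lg_mul1 : left_id lg_one lg_mul;
  lg_mulV : left_inverse lg_one lg_inv lg_mul;
  lg_mul_smooth : msmooth2 lg_mul;
  lg_inv_smooth : msmooth lg_inv
}.

Definition lie_action U V (G : lie_group U) (M : manifold V) (act : G -> M -> M) :=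
  [/\ msmooth2 act, (forall x, act (lg_one G) x = x) &
      forall a b x, act (lg_mul a b) x = act a (act b x)].

End Manifolds.

Section Riemannian.
Context (R : realType).

Notation e_ i := (delta_mx 0 i).

(* Matrix of [ip] in the coordinate basis of the chart [c], at the point of
   coordinates [y]. *)
Definition gram m (M : manifold 'rV[R]_m)
    (ip : forall x : M, tangent x -> tangent x -> R) (c : chart M 'rV[R]_m)
    (y : 'rV[R]_m) : 'M[R]_m :=
  \matrix_(i, j) ip (cinv c y) (tvec c y (e_ i)) (tvec c y (e_ j)).

Record rmetric m (M : manifold 'rV[R]_m) := RMetric {
  ip :> forall x : M, tangent x -> tangent x -> R;
  ip_linear : forall x (w : tangent x) a u v,
    ip (a *: u + v) w = a * ip u w + ip v w;
  ip_sym : forall x (u v : tangent x), ip u v = ip v u;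
  ip_pos : forall x (u : tangent x), u != 0 -> 0 < ip u u;
  ip_smooth : forall c i j, atlas c ->
    smooth_on (cimg c) (fun y => gram ip c y i j : R^o)
}.

Definition pd m (W : normedModType R) (i : 'I_m) (u : 'rV[R]_m -> W) :
    'rV[R]_m -> W :=
  fun y => 'D_(e_ i) u y.

(* Gamma^k_ij of the matrix-valued function [g]. *)
Definition christoffel m (g : 'rV[R]_m -> 'M[R]_m) (y : 'rV[R]_m)
    (k i j : 'I_m) : R :=
  2^-1 * \sum_l invmx (g y) k l *
    (pd i (fun z => g z j l : R^o) y + pd j (fun z => g z i l : R^o) y
     - pd l (fun z => g z i j : R^o) y).

(* Sign convention: positive on round spheres. *)
Definition ricci m (g : 'rV[R]_m -> 'M[R]_m) (y : 'rV[R]_m) (i j : 'I_m) : R :=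
  let Gam := christoffel g in
  \sum_k (pd k (fun z => Gam z k i j : R^o) y - pd j (fun z => Gam z k i k : R^o) y)
  + \sum_k \sum_l (Gam y k k l * Gam y l i j - Gam y k j l * Gam y l i k).

Definition einstein m (M : manifold 'rV[R]_m) (lambda : R) (g : rmetric M) :=
  forall c y i j, atlas c -> cimg c y ->
    ricci (gram g c) y i j = lambda * gram g c y i j.

Definition smooth_metric_family (V : normedModType R) m (S : manifold V) (M : manifold 'rV[R]_m)
    (g : S -> rmetric M) :=
  forall c d i j, atlas c -> atlas d ->
    smooth_on [set z : V * 'rV[R]_m | cimg c z.1 /\ cimg d z.2]
      (fun z => gram (g (cinv c z.1)) d z.2 i j : R^o).

Definition curve (V : normedModType R) (M : manifold V) := nmanifold R^o -> M.

Definition velocity (V : normedModType R) (M : manifold V) (c : curve M) (t : R) : tangent (c t) :=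
  mdiff c t (1 : R^o).

Definition geodesic m (M : manifold 'rV[R]_m) (g : rmetric M) (c : curve M) :=
  msmooth c /\ forall (t : R) (k : 'I_m),
    let d := chart_at (c t) in
    let u i : R -> R^o := fun s => cmap d (c s) 0 i in
    derive1n 2 (u k) t + \sum_i \sum_j
      christoffel (gram g d) (cmap d (c t)) k i j * derive1 (u i) t * derive1 (u j) t = 0.

(* [q' = exp_q v] *)
Definition is_exp m (M : manifold 'rV[R]_m) (g : rmetric M) (q : M)
    (v : tangent q) (q' : M) :=
  exists c : curve M,
    [/\ geodesic g c, c 0 = q, velocity c 0 = v :> 'rV[R]_m & c 1 = q'].

(* trace_g of the second fundamental form of [f], computed in the preferred
   charts at [x] and [f x]. *)
Definition tension m n (M : manifold 'rV[R]_m) (N : manifold 'rV[R]_n)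
    (g : rmetric M) (h : rmetric N) (f : M -> N) (x : M) : tangent (f x) :=
  let c := chart_at x in
  let d := chart_at (f x) in
  let y := cmap c x in
  let u a : 'rV[R]_m -> R^o := fun z => rep f c d z 0 a in
  \row_a \sum_i \sum_j invmx (gram g c y) i j *
    (pd i (pd j (u a)) y
     - \sum_k christoffel (gram g c) y k i j * pd k (u a) y
     + \sum_b \sum_b' christoffel (gram h d) (cmap d (f x)) a b b'
         * pd i (u b) y * pd j (u b') y).

Definition harmonic m n (M : manifold 'rV[R]_m) (N : manifold 'rV[R]_n)
    (g : rmetric M) (h : rmetric N) (f : M -> N) :=
  forall x, tension g h f x = 0.

Definition isometric_action (V : normedModType R) m (G : lie_group V) (M : manifold 'rV[R]_m)
    (act : G -> M -> M) (g : rmetric M) :=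
  forall a x (v w : tangent x), g _ (mdiff (act a) x v) (mdiff (act a) x w) = g x v w.

(* Dimension of the orbit of [x]: rank at the identity of [a |-> a x]. *)
Definition orbit_dim l m (G : lie_group 'rV[R]_l) (M : manifold 'rV[R]_m)
    (act : G -> M -> M) (x : M) : nat :=
  \rank (lin1_mx (mdiff (fun a : G => act a x) (lg_one G) : 'rV[R]_l -> 'rV[R]_m)).

Definition cohomogeneity_one l m (G : lie_group 'rV[R]_l) (M : manifold 'rV[R]_m)
    (act : G -> M -> M) :=
  (forall x, (orbit_dim act x).+1 <= m)%N /\ exists x, (orbit_dim act x).+1 = m.

Definition unit_normal_geodesic l m (G : lie_group 'rV[R]_l)
    (M : manifold 'rV[R]_m) (act : G -> M -> M) (g : rmetric M) (c : curve M) :=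
  [/\ geodesic g c,
      (forall t, g (c t) (velocity c t) (velocity c t) = 1) &
      forall t (xi : 'rV[R]_l),
        g (c t) (velocity c t) (mdiff (fun a : G => act a (c t)) (lg_one G) xi) = 0].

Section Equivariance.
Context l m n (G : lie_group 'rV[R]_l) (M : manifold 'rV[R]_m)
  (N : manifold 'rV[R]_n) (actM : G -> M -> M) (actN : G -> N -> N).

Definition equivariant (f : M -> N) := forall a x, f (actM a x) = actN a (f x).

Definition equivariantly_homotopic (f f' : M -> N) :=
  exists H : R -> M -> N,
    [/\ continuous (fun z : R * M => H z.1 z.2), (forall t, equivariant (H t)),
        H 0 = f & H 1 = f'].

(* Sections of [f^* TN]. *)
Definition vsection (f : M -> N) := forall x : M, tangent (f x).

Definition equivariant_section (f : M -> N) (s : vsection f) :=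
  forall a x, s (actM a x) = mdiff (actN a) (f x) (s x) :> 'rV[R]_n.

End Equivariance.

Definition iterpd m (W : normedModType R) (I : seq 'I_m) (u : 'rV[R]_m -> W) :=
  foldr (@pd m W) u I.

Definition holder_norm m n (k : nat) (alpha : R) (K : set 'rV[R]_m)
    (u : 'rV[R]_m -> 'rV[R]_n) : \bar R :=
  (maxe 0 (ereal_sup [set z | exists I y,
      [/\ (size I <= k)%N, K y & z = `|iterpd I u y|%:E]])
   + maxe 0 (ereal_sup [set z | exists I y y',
      [/\ size I = k, K y, K y', y <> y' &
        z = (`|iterpd I u y - iterpd I u y'| / `|y - y'| `^ alpha)%:E]]))%E.

Definition holder_on m n (k : nat) (alpha : R) (U : set 'rV[R]_m)
    (u : 'rV[R]_m -> 'rV[R]_n) :=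
  Ck_on k U u /\
  forall K, compact K -> K `<=` U -> (holder_norm k alpha K u < +oo)%E.

Section Hoelder.
Context m n (M : manifold 'rV[R]_m) (N : manifold 'rV[R]_n).

Definition holder_map (k : nat) (alpha : R) (f : M -> N) :=
  continuous f /\ forall c d, atlas c -> atlas d ->
    holder_on k alpha (rep_dom f c d) (rep f c d).

Definition srep (f : M -> N) (s : vsection f) (c : chart M 'rV[R]_m)
    (d : chart N 'rV[R]_n) : 'rV[R]_m -> 'rV[R]_n :=
  fun y => tcoord d (s (cinv c y)).

Definition holder_section (k : nat) (alpha : R) (f : M -> N) (s : vsection f) :=
  forall c d, atlas c -> atlas d ->
    holder_on k alpha (rep_dom f c d) (srep s c d).

(* [iota] identifies the normed space [E] with the space of [C^{k,alpha}]
   sections of [f^* TN] satisfying the linear condition [P], the norm of [E]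
   being equivalent to the Hoelder norm computed in some (equivalently, any)
   finite cover of [M] by compact coordinate patches. *)
Record holder_space (k : nat) (alpha : R) (f : M -> N) (P : set (vsection f))
    (E : normedModType R) (iota : E -> vsection f) : Prop := HolderSpace {
  hs_linear : forall a u v x, iota (a *: u + v) x = a *: iota u x + iota v x;
  hs_inj : injective iota;
  hs_range : range iota = [set s | holder_section k alpha s /\ P s];
  hs_norm : exists r, exists (c : 'I_r -> chart M 'rV[R]_m)
      (d : 'I_r -> chart N 'rV[R]_n) (K : 'I_r -> set 'rV[R]_m) (B : R),
    [/\ (forall i, [/\ atlas (c i), atlas (d i), compact (K i) &
                      K i `<=` rep_dom f (c i) (d i)]),
        (forall x, exists i y, K i y /\ cinv (c i) y = x),
        0 < B &
        forall v,
          (\sum_(i < r) holder_norm k alpha (K i) (srep (iota v) (c i) (d i))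
             <= (B * `|v|)%:E)%E /\
          (`|v|%:E <= B%:E *
             \sum_(i < r) holder_norm k alpha (K i) (srep (iota v) (c i) (d i)))%E]
}.

End Hoelder.

End Riemannian.

(* The endpoint, smoothness and normalization conditions on maps, and the
   corresponding conditions on sections, are the parameters [pr_cond] and
   [pr_scond]. *)
Record probe (R : realType) := Probe {
  pr_s : nat; pr_l : nat; pr_m : nat; pr_n : nat;
  pr_S : manifold 'rV[R]_pr_s;
  pr_G : lie_group 'rV[R]_pr_l;
  pr_M : manifold 'rV[R]_pr_m;
  pr_N : manifold 'rV[R]_pr_n;
  pr_p0 : pr_S;
  pr_actM : pr_G -> pr_M -> pr_M;
  pr_g : pr_S -> rmetric pr_M;
  pr_lambda : R;
  pr_gamma : curve pr_M;
  pr_actN : pr_G -> pr_N -> pr_N;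
  pr_h : rmetric pr_N;
  pr_k : nat;
  pr_alpha : R;
  pr_cond : set (pr_M -> pr_N);
  pr_scond : forall f : pr_M -> pr_N, set (vsection f);
  pr_f0 : pr_M -> pr_N;

  pr_S_countable : @second_countable pr_S;
  pr_G_countable : @second_countable pr_G;
  pr_M_compact : compact [set: pr_M];
  pr_actM_action : lie_action pr_actM;
  pr_actM_cohom1 : cohomogeneity_one pr_actM;
  pr_lambda_gt0 : 0 < pr_lambda;
  pr_g_smooth : smooth_metric_family pr_g;
  pr_g_invariant : forall p, isometric_action pr_actM (pr_g p);
  pr_g_einstein : forall p, einstein pr_lambda (pr_g p);
  pr_g_normalized : forall p, unit_normal_geodesic pr_actM (pr_g p) pr_gamma;

  pr_N_compact : compact [set: pr_N];
  pr_actN_action : lie_action pr_actN;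
  pr_h_invariant : isometric_action pr_actN pr_h;
  pr_k_ge4 : (4 <= pr_k)%N;
  pr_alpha_itv : 0 < pr_alpha < 1;

  pr_f0_holder : holder_map pr_k.+2 pr_alpha pr_f0;
  pr_f0_equivariant : equivariant pr_actM pr_actN pr_f0;
  pr_f0_cond : pr_cond pr_f0;
  pr_f0_harmonic : harmonic (pr_g pr_p0) pr_h pr_f0
}.

Arguments pr_p0 {R} _.
Arguments pr_actM {R} _ _ _.
Arguments pr_actN {R} _ _ _.
Arguments pr_g {R} _ _.
Arguments pr_cond {R} _ _.
Arguments pr_scond {R} _ _ _.
Arguments pr_f0 {R} _ _.

Section Core.
Context (R : realType).

(* The equivariant homotopy class is that of the reference map. *)
Definition admissible (D : probe R) (f : pr_M D -> pr_N D) :=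
  [/\ holder_map (pr_k D).+2 (pr_alpha D) f,
      equivariant (pr_actM D) (pr_actN D) f,
      equivariantly_homotopic (pr_actM D) (pr_actN D) (pr_f0 D) f &
      pr_cond D f].

Definition admissible_section (D : probe R) (f : pr_M D -> pr_N D)
    (s : vsection f) :=
  equivariant_section (pr_actM D) (pr_actN D) s /\ pr_scond D f s.

(* Local trivializations around the reference map.

   [tr_full] is the Banach space of equivariant [C^{k+2,alpha}] sections of
   [f0^* TN]; [s |-> exp_{f0} s] is the usual chart of the manifold of
   equivariant maps.  In this chart the admissible maps form a split Banach
   submanifold, straightened by the diffeomorphism [tr_slice] from
   [tr_W] in [tr_E * tr_cmpl] onto [tr_O] in [tr_full]; [tr_E] is thus the
   model of the constrained space of maps.  [tr_F] is the constrained space of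
   [C^{k,alpha}] sections of [f0^* TN], to which the sections along nearby
   maps are brought back by the fibrewise isomorphisms [tr_transport].

   [tr_tension] is the tension field in these trivializations. *)
Record trivialization (D : probe R) := Trivialization {
  tr_full : completeNormedModType R;
  tr_E : completeNormedModType R;
  tr_cmpl : completeNormedModType R;
  tr_F : completeNormedModType R;
  tr_iota : tr_full -> vsection (pr_f0 D);
  tr_exp : tr_full -> pr_M D -> pr_N D;
  tr_W : set (tr_E * tr_cmpl);
  tr_O : set tr_full;
  tr_slice : tr_E * tr_cmpl -> tr_full;
  tr_unslice : tr_full -> tr_E * tr_cmpl;
  tr_iotaF : tr_F -> vsection (pr_f0 D);
  tr_dom : set tr_E := [set u | tr_W (u, 0)];
  tr_map : tr_E -> pr_M D -> pr_N D := fun u => tr_exp (tr_slice (u, 0));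
  tr_transport : forall u x,
    {linear tangent (pr_f0 D x) -> tangent (tr_map u x)};
  tr_tension : pr_S D -> tr_E -> tr_F;

  tr_iotaP : holder_space (pr_k D).+2 (pr_alpha D)
    [set s : vsection (pr_f0 D) |
       equivariant_section (pr_actM D) (pr_actN D) s] tr_iota;
  tr_expP : forall s x, is_exp (pr_h D) (tr_iota s x) (tr_exp s x);
  tr_W_open : open tr_W;
  tr_O_open : open tr_O;
  tr_W0 : tr_W (0, 0);
  tr_slice0 : tr_slice (0, 0) = 0;
  tr_slice_img : tr_slice @` tr_W = tr_O;
  tr_sliceK : forall z, tr_W z -> tr_unslice (tr_slice z) = z;
  tr_slice_smooth : smooth_on tr_W tr_slice;
  tr_unslice_smooth : smooth_on tr_O tr_unslice;
  tr_slice_admissible : forall z, tr_W z ->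
    admissible (tr_exp (tr_slice z)) <-> z.2 = 0;

  tr_iotaFP : holder_space (pr_k D) (pr_alpha D)
    [set s : vsection (pr_f0 D) | admissible_section s] tr_iotaF;
  tr_transport_bij : forall u x, tr_dom u -> bijective (tr_transport u x);
  tr_transport0 : forall x v, tr_transport 0 x v = v :> 'rV[R]_(pr_n D);
  tr_transport_section : forall u (s : vsection (pr_f0 D)), tr_dom u ->
    (holder_section (pr_k D) (pr_alpha D) s /\ admissible_section s) <->
    (holder_section (pr_k D) (pr_alpha D)
       ((fun x => tr_transport u x (s x)) : vsection (tr_map u)) /\
     admissible_section ((fun x => tr_transport u x (s x)) : vsection (tr_map u)));

  tr_tensionP : forall p u x, tr_dom u ->
    tension (pr_g D p) (pr_h D) (tr_map u) x
    = tr_transport u x (tr_iotaF (tr_tension p u) x);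
  tr_tension_smooth : forall c : chart (pr_S D) 'rV[R]_(pr_s D), atlas c ->
    smooth_on [set z : 'rV[R]_(pr_s D) * tr_E | cimg c z.1 /\ tr_dom z.2]
      (fun z => tr_tension (cinv c z.1) z.2)
}.

Arguments tr_tension {D} t p u.
Arguments tr_dom {D} t.
Arguments tr_map {D} t u x.

Definition inverse_operators (E F : normedModType R) (J : clin E F) (G : clin F E) :=
  cancel J G /\ cancel G J.

(* [0] is the coordinate of [f0]. *)
Definition jacobi_nondegenerate (D : probe R) (T : trivialization D) :=
  exists (J : clin (tr_E T) (tr_F T)) (G : clin (tr_F T) (tr_E T)),
    (forall v, J v = 'd (tr_tension T (pr_p0 D)) (0 : tr_E T) v) /\
    inverse_operators J G.

(* [S] is understood to be already shrunk around [p0].  [cp_u p] is the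
   coordinate, in the trivialization, of the harmonic map [f_p].  The
   trivialized [J_p] is the intrinsic linearization because the tension field
   vanishes at [f_p].

   [cp_X] is the Banach manifold of operator data: its points are pairs of
   operators, through the smooth injection [cp_op].  This covers the whole
   space of pairs, its open subsets, and the submanifold of mutually inverse
   pairs. *)
Record core_package (D : probe R) (T : trivialization D) := CorePackage {
  cp_u : pr_S D -> tr_E T;
  cp_J : pr_S D -> clin (tr_E T) (tr_F T);
  cp_G : pr_S D -> clin (tr_F T) (tr_E T);
  cp_XV : completeNormedModType R;
  cp_X : manifold cp_XV;
  cp_op : cp_X -> nmanifold (clin (tr_E T) (tr_F T) * clin (tr_F T) (tr_E T))%type;
  cp_A : pr_S D -> cp_X;
  cp_f : pr_S D -> pr_M D -> pr_N D := fun p => tr_map T (cp_u p);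

  cp_u0 : cp_u (pr_p0 D) = 0;
  cp_u_dom : forall p, tr_dom T (cp_u p);
  cp_u_smooth : msmooth (cp_u : pr_S D -> nmanifold (tr_E T));
  cp_harmonic : forall p, harmonic (pr_g D p) (pr_h D) (cp_f p);
  cp_unique : forall p u, tr_dom T u ->
    harmonic (pr_g D p) (pr_h D) (tr_map T u) -> u = cp_u p;
  cp_JP : forall p v, cp_J p v = 'd (tr_tension T p) (cp_u p) v;
  cp_GP : forall p, inverse_operators (cp_J p) (cp_G p);
  cp_op_inj : injective cp_op;
  cp_op_smooth : msmooth cp_op;
  cp_AP : forall p, cp_op (cp_A p) = (cp_J p, cp_G p);
  cp_A_smooth : msmooth cp_A
}.

Arguments cp_A {D T} c p.

Definition universal_response (D : probe R) (T : trivialization D)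
    (C : core_package T) :
    {linear tangent (pr_p0 D) -> tangent (cp_A C (pr_p0 D))} :=
  mdiff (cp_A C) (pr_p0 D).

Definition response_operator (D : probe R) (Y : normedModType R)
    (Theta : pr_S D -> nmanifold Y) : {linear tangent (pr_p0 D) -> Y} :=
  mdiff Theta (pr_p0 D).

Definition generated_by (D : probe R) (T : trivialization D) (C : core_package T)
    (Y : normedModType R) (Psi : cp_X C -> nmanifold Y)
    (Theta : pr_S D -> nmanifold Y) :=
  [/\ msmooth Theta, msmooth Psi & Theta = Psi \o cp_A C].

Definition core_generated (D : probe R) (T : trivialization D)
    (C : core_package T) (Y : normedModType R) (Theta : pr_S D -> nmanifold Y) :=
  exists Psi : cp_X C -> nmanifold Y, generated_by Psi Theta.

End Core.

(* Main.v *)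
Require Import Defs.
From mathcomp Require Import all_boot all_order all_algebra.
From mathcomp Require Import all_classical all_reals all_analysis.

Set Implicit Arguments.
Unset Strict Implicit.
Unset Printing Implicit Defensive.

Import numFieldNormedType.Exports.

Local Open Scope classical_set_scope.
Local Open Scope ring_scope.

(** The factorization is the chain rule for smooth maps between Banach manifolds, applied to
    [Psi \o cp_A C] at the base point. Differentials are read in preferred charts, so the manifold
    chain rule [mdiff_comp] reduces to the Fréchet one: near the base point the representative of a
    composite is the composite of the representatives ([rep_comp_near]), and a differential depends
    only on the germ ([near_eq_diff]). *)

Lemma near_eq_diff (R : numFieldType) (V W : normedModType R) (f g : V -> W)
    (x : V) :
  (\near x, f x = g x) -> differentiable f x -> 'd g x = 'd f x :> (V -> W).
Proof.
move=> fg df; apply: diff_unique; first exact: diff_continuous.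
have fgx : f x = g x := nbhs_singleton fg.
have /eqaddoP fo := diff_locally df.
apply/eqaddoP => e e0; have := fo e e0; apply: filter_app.
(* Recenter the agreement at 0, where the little-o estimate on increments lives. *)
move: fg; rewrite (near_shift 0 x) GRing.subr0.
apply: filterS => y /= fgy.
by rewrite -![(_ + _ : _ -> _) _]/(_ + _) -![(- _ : _ -> _) _]/(- _)
  -![(_ + _ : _ -> _) _]/(_ + _) /= /cst fgx fgy.
Qed.

Lemma smooth_on_differentiable (R : realType) (V W : normedModType R)
    (U : set V) (f : V -> W) (x : V) :
  smooth_on U f -> U x -> differentiable f x.
Proof. by move=> /(_ 1)[+ _]; exact. Qed.

Lemma msmooth_differentiable (R : realType) (V W : normedModType R)
    (A : manifold V) (B : manifold W) (f : A -> B) (x : A) :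
  msmooth f ->
  differentiable (rep f (chart_at x) (chart_at (f x))) (cmap (chart_at x) x).
Proof.
move=> [_ /(_ _ _ (chart_at_atlas x) (chart_at_atlas (f x))) sf].
apply: smooth_on_differentiable sf _; split.
  by exists x => //; exact: chart_at_dom.
by rewrite cmapK; exact: chart_at_dom.
Qed.

(** The type of [mdiff] records linearity alone; in infinite dimension boundedness has to come from
    Fréchet differentiability. *)
Lemma mdiff_continuous (R : realType) (V W : normedModType R)
    (A : manifold V) (B : manifold W) (f : A -> B) (x : A) :
  msmooth f -> continuous (mdiff f x : V -> W).
Proof. by move=> /(msmooth_differentiable x)/diff_continuous. Qed.

Section ChainRule.
Context (R : realType) (U V W : normedModType R).
Context (A : manifold U) (B : manifold V) (C : manifold W).

(* Only near [cmap c x]: elsewhere [f] may leave the domain of [d], where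
   [cinv d] need not invert [cmap d]. *)
Lemma rep_comp_near (f : A -> B) (g : B -> C) (c : chart A U) (d : chart B V)
    (e : chart C W) (x : A) :
  {for x, continuous f} -> cdom c x -> cdom d (f x) ->
  \forall y \near cmap c x,
    (rep g d e \o rep f c d) y = rep (g \o f) c e y.
Proof.
move=> cf cx dfx.
have ci : {for cmap c x, continuous (cinv c)}.
  by apply: cinv_continuous; exists x.
have : nbhs (cmap c x) ((f \o cinv c) @^-1` cdom d).
  have : {for cmap c x, continuous (f \o cinv c)}.
    by apply: continuous_comp => //; rewrite cmapK.
  by apply; rewrite /= cmapK//; apply: open_nbhs_nbhs; split=> //; exact: cdom_open.
by apply: filterS => y /= dy; rewrite /rep /= cmapK.
Qed.

(** The chart [chart_at (f x)] serves both as target chart for [f] and as source chart for [g], so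
    no transition map appears. *)
Lemma mdiff_comp (f : A -> B) (g : B -> C) (x : A) :
  msmooth f -> msmooth g ->
  mdiff (g \o f) x = mdiff g (f x) \o mdiff f x :> (U -> W).
Proof.
move=> sf sg.
have df := msmooth_differentiable x sf.
(* The coordinate at which [g] is differentiated is the value of the representative of [f], as the
   Fréchet chain rule requires. *)
have fE : rep f (chart_at x) (chart_at (f x)) (cmap (chart_at x) x) =
    cmap (chart_at (f x)) (f x).
  by rewrite /rep /= cmapK//; exact: chart_at_dom.
have dg := msmooth_differentiable (f x) sg.
rewrite -fE in dg.
have E := rep_comp_near g (chart_at (g (f x))) (sf.1 x) (chart_at_dom x)
  (chart_at_dom (f x)).
by rewrite /mdiff /= (near_eq_diff E (differentiable_comp df dg)) diff_comp// fE.
Qed.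

End ChainRule.

Theorem theorem5p28 (R : realType) (D : probe R) (T : trivialization D)
    (nondegenerate : jacobi_nondegenerate T) (C : core_package T) :
  (forall (Y : normedModType R) (Psi : cp_X C -> nmanifold Y)
      (Theta : pr_S D -> nmanifold Y),
    findim Y -> generated_by Psi Theta ->
    (response_operator Theta : tangent (pr_p0 D) -> Y)
      = mdiff Psi (cp_A C (pr_p0 D)) \o universal_response C
    /\ (mdiff Theta (pr_p0 D) : tangent (pr_p0 D) -> Y)
      = mdiff Psi (cp_A C (pr_p0 D)) \o mdiff (cp_A C) (pr_p0 D))
  /\
  (forall (Y : normedModType R) (Theta : pr_S D -> nmanifold Y),
    findim Y -> core_generated C Theta ->
    exists L : {linear tangent (cp_A C (pr_p0 D)) -> Y},
      continuous L /\
      (response_operator Theta : tangent (pr_p0 D) -> Y)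
        = L \o universal_response C).
Proof.
have chain (Y : normedModType R) Psi (Theta : pr_S D -> nmanifold Y) :
    generated_by (C := C) Psi Theta ->
    (mdiff Theta (pr_p0 D) : tangent (pr_p0 D) -> Y)
      = mdiff Psi (cp_A C (pr_p0 D)) \o mdiff (cp_A C) (pr_p0 D).
  by case=> _ sPsi ->; exact: mdiff_comp (cp_A_smooth C) sPsi.
split=> [Y Psi Theta _ gen|Y Theta _ [Psi gen]]; first by split; exact: chain.
(* The two response operators unfold to [mdiff], so [chain] applies up to conversion. *)
exists (mdiff Psi (cp_A C (pr_p0 D))); split; last exact: chain.
by case: gen => _ sPsi _; exact: mdiff_continuous.
Qed.
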